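(* Let $G$ be one of the simply laced groups in Deligne's exceptional series, i.e. $G$ is of type $A_1$, $A_2$, $D_4$, $E_6$, $E_7$ or $E_8$. Then the Coxeter number $h(G)$ and the rank $\mathrm{rk}(G)$ satisfy $$h(G)=\frac{6(\mathrm{rk}(G)+2)}{10-\mathrm{rk}(G)} .$$
   Context: The Coxeter number $h(G)$ of a simple group $G$ is the order of a Coxeter element of its Weyl group. The groups concerned are $SU(2),SU(3),SO(8),E_6,E_7,E_8$. *)

(* Defs.v *)
From HB Require Import structures.
From mathcomp Require Import all_boot all_order all_algebra.
From mathcomp Require Import all_classical all_reals all_analysis.
Import Order.TTheory GRing.Theory Num.Theory.
Import numFieldNormedType.Exports.
Set Implicit Arguments.
Unset Strict Implicit.
Unset Printing Implicit Defensive.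
Local Open Scope classical_set_scope.
Local Open Scope ring_scope.

Section CompactGroups.
Context {R : realType} {N : nat}.
Implicit Types (G T : set 'M[R]_N) (g t : {vspace 'M[R]_N}).
Implicit Types (A B H X Y : 'M[R]_N) (s D : seq 'M[R]_N).

(* Compact Lie groups are realized as closed subgroups of the orthogonal group
   O(N); every compact Lie group is isomorphic to one of these (Peter-Weyl).
   The inverse of X is then its transpose. *)
Definition compact_lie_group G : Prop :=
  [/\ closed G,
      forall X, G X -> X *m X^T = 1%:M,
      G 1%:M,
      forall X Y, G X -> G Y -> G (X *m Y) &
      forall X, G X -> G X^T].

(* g consists of the velocities at the identity of the curves drawn on G. *)
Definition is_lie_algebra_of G g : Prop :=
  forall X, X \in g <->
    exists gamma : R -> 'M[R]_N,
      [/\ gamma 0 = 1%:M, forall u, G (gamma u) & is_derive (0 : R) 1 gamma X].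

Definition lie_bracket X Y : 'M[R]_N := X *m Y - Y *m X.

Definition lie_ideal g (I : {vspace 'M[R]_N}) : Prop :=
  (I <= g)%VS /\
  forall X Y, X \in g -> Y \in I -> lie_bracket X Y \in I.

Definition simple_lie_algebra g : Prop :=
  (exists X Y, [/\ X \in g, Y \in g & lie_bracket X Y != 0]) /\
  (forall I, lie_ideal g I -> I = 0%VS \/ I = g).

(* As usual for Lie groups, G is simple when it is connected and its Lie
   algebra is simple, so that G may have a finite center, as SU(2) does. *)
Definition simple_compact_lie_group G g : Prop :=
  [/\ compact_lie_group G, connected G, is_lie_algebra_of G g &
      simple_lie_algebra g].

Definition torus_in G T : Prop :=
  [/\ T `<=` G, compact_lie_group T, connected T &
      forall X Y, T X -> T Y -> X *m Y = Y *m X].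

Definition maximal_torus G T : Prop :=
  torus_in G T /\ forall T', torus_in G T' -> T `<=` T' -> T' = T.

(* The trace form, positive definite and invariant under conjugation by O(N);
   it identifies t with its dual, so that roots and coroots live in t. *)
Definition ip A B : R := \tr (A^T *m B).

(* A nonzero A in t is a root when some X + iY <> 0 in the complexification
   of g satisfies [H, X + iY] = i <A, H> (X + iY) for every H in t; below are
   the real and imaginary parts of that equation. *)
Definition is_root g t A : Prop :=
  [/\ A \in t, A != 0 &
      exists X Y,
        [/\ X \in g, Y \in g, (X != 0) || (Y != 0) &
            forall H, H \in t ->
              lie_bracket H X = - ip A H *: Y /\
              lie_bracket H Y = ip A H *: X]].

Definition cartan_integer A B : R := 2 * ip A B / ip A A.

Definition reflection A : 'M[R]_N -> 'M[R]_N :=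
  fun H => H - cartan_integer A H *: A.

(* Elements of the Weyl group act on t; the reflections are written on the
   whole space of matrices, and act trivially on the complement of t. *)
Inductive weyl_group g t : ('M[R]_N -> 'M[R]_N) -> Prop :=
| weyl_id : weyl_group g t idfun
| weyl_reflection A w :
    is_root g t A -> weyl_group g t w -> weyl_group g t (reflection A \o w).

Definition is_base g t D : Prop :=
  [/\ free D,
      forall A, A \in D -> is_root g t A &
      forall A, is_root g t A ->
        exists k : nat -> nat,
          A = \sum_(i < size D) D`_i *+ k i \/
          A = - \sum_(i < size D) D`_i *+ k i].

Definition product_of_reflections s : 'M[R]_N -> 'M[R]_N :=
  foldr (fun A w => reflection A \o w) idfun s.

Definition coxeter_element g t D (c : 'M[R]_N -> 'M[R]_N) : Prop :=
  weyl_group g t c /\ exists2 s, perm_eq s D & c = product_of_reflections s.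

Definition trivial_on t (w : 'M[R]_N -> 'M[R]_N) : Prop :=
  forall H, H \in t -> w H = H.

Definition has_order t (w : 'M[R]_N -> 'M[R]_N) (m : nat) : Prop :=
  [/\ (0 < m)%N, trivial_on t (iter m w) &
      forall k, (0 < k < m)%N -> ~ trivial_on t (iter k w)].

(* The order does not depend on the order in which the simple reflections are
   multiplied, hence the quantification over all Coxeter elements. *)
Definition is_coxeter_number g t D (h : nat) : Prop :=
  (exists c, coxeter_element g t D c) /\
  forall c, coxeter_element g t D c -> has_order t c h.

(* The rank is the dimension of a maximal torus. *)
Definition rank t : nat := \dim t.

End CompactGroups.

Inductive deligne_ade := A1 | A2 | D4 | E6 | E7 | E8.

(* Bourbaki labels, shifted to start from 0; the central node of D4 is 1. *)
Definition dynkin_nodes (X : deligne_ade) : nat :=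
  match X with A1 => 1 | A2 => 2 | D4 => 4 | E6 => 6 | E7 => 7 | E8 => 8 end.

Definition dynkin_edges (X : deligne_ade) : seq (nat * nat) :=
  match X with
  | A1 => [::]
  | A2 => [:: (0, 1)]
  | D4 => [:: (0, 1); (1, 2); (1, 3)]
  | E6 => [:: (0, 2); (2, 3); (1, 3); (3, 4); (4, 5)]
  | E7 => [:: (0, 2); (2, 3); (1, 3); (3, 4); (4, 5); (5, 6)]
  | E8 => [:: (0, 2); (2, 3); (1, 3); (3, 4); (4, 5); (5, 6); (6, 7)]
  end%N.

Definition cartan_matrix (X : deligne_ade) (i j : nat) : int :=
  if i == j then 2
  else if ((i, j) \in dynkin_edges X) || ((j, i) \in dynkin_edges X) then -1
  else 0.

Definition has_dynkin_type (R : realType) (N : nat) (D : seq 'M[R]_N)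
    (X : deligne_ade) : Prop :=
  exists s : seq 'M[R]_N,
    [/\ perm_eq s D, size s = dynkin_nodes X &
        forall i j, (i < size s)%N -> (j < size s)%N ->
          cartan_integer s`_i s`_j = (cartan_matrix X i j)%:~R].

(* Main.v *)
From HB Require Import structures.
Require Import Defs.
From mathcomp Require Import all_boot all_order all_algebra.
From mathcomp Require Import all_classical all_reals all_analysis.
From mathcomp Require Import lra zify complex.
Import Order.TTheory GRing.Theory Num.Theory.
Import numFieldNormedType.Exports.
Set Implicit Arguments.
Unset Strict Implicit.
Unset Printing Implicit Defensive.
Local Open Scope ring_scope.

(* The rank is the number of simple roots because the roots span t: a nonzero H
   in t orthogonal to all roots would be central in g (otherwise ad t has a
   common eigenvector in the complexified image of ad H, giving a root that is
   not orthogonal to H), so that the line through H would be an ideal.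

   The order of the Coxeter elements is a computation in the integral
   coordinates given by the simple roots. A product of all simple reflections
   in any order is a word in the nodes of the diagram, which the commutation
   relations bring to one of a short list of normal forms; each of these acts
   with the expected order. *)

(** * Calculus of matrix-valued curves *)

Lemma is_derive_mxP (R : realType) m n (f : R -> 'M[R]_(m, n)) (x v : R)
    (df : 'M[R]_(m, n)) :
  is_derive x v f df <->
  forall i j, is_derive x v (fun u => f u i j) (df i j).
Proof.
split=> [[fx dfx] i j|dfx].
  split; first by move/derivable_mxP: fx; exact.
  by rewrite -dfx (derive_mx fx) mxE.
have fx : derivable f x v by apply/derivable_mxP => i j; case: (dfx i j).
split=> //; rewrite (derive_mx fx); apply/matrixP => i j; rewrite mxE.
exact: derive_val.
Qed.

Lemma is_derive_mulmx (R : realType) m n p (f : R -> 'M[R]_(m, n))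
    (h : R -> 'M[R]_(n, p)) (x v : R) df dh :
  is_derive x v f df -> is_derive x v h dh ->
  is_derive x v (fun u => f u *m h u) (f x *m dh + df *m h x).
Proof.
move=> /is_derive_mxP fx /is_derive_mxP hx; apply/is_derive_mxP => i j.
rewrite (_ : (fun u => _) =
    \sum_k ((fun u => f u i k) * (fun u => h u k j))); last first.
  by apply/funext => u; rewrite mxE fct_sumE.
apply: (is_derive_eq (is_derive_sum (fun k => is_deriveM (fx i k) (hx k j)))).
rewrite !mxE -big_split; apply: eq_bigr => k _ /=.
by congr (_ + _); rewrite /GRing.scale /= mulrC.
Qed.

(** Flattened by [mxvec], [L] is right multiplication by the constant matrix [lin_mx L], so the
    product rule applies. *)
Lemma is_derive_linear (R : realType) m n p q
    (L : {linear 'M[R]_(m, n) -> 'M[R]_(p, q)}) (f : R -> 'M[R]_(m, n))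
    (x v : R) df :
  is_derive x v f df -> is_derive x v (L \o f) (L df).
Proof.
move=> fx.
have fx' : is_derive x v (mxvec \o f) (mxvec df).
  apply/is_derive_mxP => i k; rewrite ord1; case/mxvec_indexP: k => a b.
  rewrite mxvecE (_ : (fun u => _) = (fun u => f u a b)).
    by move/is_derive_mxP : fx; exact.
  by apply/funext => u /=; rewrite mxvecE.
have := is_derive_mulmx fx' (is_derive_cst (lin_mx L) x v).
rewrite mulmx0 add0r mul_vec_lin => /is_derive_mxP Lx.
apply/is_derive_mxP => i j; move: (Lx 0 (mxvec_index i j)); rewrite mxvecE.
rewrite (_ : (fun u => (_ *m _) _ _) = (fun u => (L \o f) u i j)) //.
by apply/funext => u /=; rewrite mul_vec_lin mxvecE.
Qed.

(** The complementary projection [\1 - projv U] kills [f], hence also its derivative. *)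
Lemma is_derive_mem_vspace (R : realType) m n (U : {vspace 'M[R]_(m, n)})
    (f : R -> 'M[R]_(m, n)) (x v : R) df :
  (forall u, f u \in U) -> is_derive x v f df -> df \in U.
Proof.
move=> fU /(is_derive_linear (\1 - projv U)%VF) => -[_].
rewrite (_ : _ \o f = cst 0) ?derive_cst; last first.
  by apply/funext => u /=; rewrite add_lfunE opp_lfunE id_lfunE projv_id ?subrr.
move/esym/eqP; rewrite /= add_lfunE opp_lfunE id_lfunE subr_eq0 => /eqP ->.
exact: memv_proj.
Qed.

(** * The Lie algebra of a closed subgroup of the orthogonal group *)

Section LieAlgebra.
Context {R : realType} {N : nat}.
Implicit Types (G T : set 'M[R]_N) (g t : {vspace 'M[R]_N}).
Implicit Types (A B H K X Y : 'M[R]_N) (D : seq 'M[R]_N).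

(** Differentiate [gamma u *m (gamma u)^T = 1%:M] at 0. *)
Lemma lie_algebra_skew G g X :
  compact_lie_group G -> is_lie_algebra_of G g -> X \in g -> X^T = - X.
Proof.
move=> [_ Gorth _ _ _] gG /gG[gamma [g0 gammaG dgamma]].
have [_] := is_derive_mulmx dgamma (is_derive_linear trmx dgamma).
rewrite (_ : (fun u => _) = cst 1%:M) ?derive_cst; last first.
  by apply/funext => u /=; rewrite Gorth.
rewrite /= g0 mul1mx trmx1 mulmx1 => /esym/eqP.
by rewrite addr_eq0 => /eqP.
Qed.

Lemma lie_algebraS G T g t :
  (T `<=` G)%classic -> is_lie_algebra_of G g -> is_lie_algebra_of T t ->
  {subset t <= g}.
Proof.
move=> TG gG tT X /tT[gamma [g0 gammaT dgamma]]; apply/gG.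
by exists gamma; split=> // u; apply: TG.
Qed.

(** Conjugating [Y] by [gamma u] gives a curve in the subspace [g]. Its velocity at 0 is
    [X *m Y + Y *m X^T], which is the bracket because [X] is skew. *)
Lemma lie_algebra_bracket G g X Y :
  compact_lie_group G -> is_lie_algebra_of G g ->
  X \in g -> Y \in g -> lie_bracket X Y \in g.
Proof.
move=> cG gG Xg Yg; have [_ Gorth G1 GM GV] := cG.
have [gamma [gamma0 gammaG dgamma]] := (gG X).1 Xg.
have [delta [delta0 deltaG ddelta]] := (gG Y).1 Yg.
have GammaY u : gamma u *m Y *m (gamma u)^T \in g.
  apply/gG; exists (fun v => gamma u *m delta v *m (gamma u)^T); split.
  - by rewrite delta0 mulmx1 Gorth.
  - by move=> v; apply: (GM _ _ (GM _ _ _ _) (GV _ _)).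
  - have d1 := is_derive_mulmx (is_derive_cst (gamma u) (0 : R) (1 : R)) ddelta.
    have := is_derive_mulmx d1 (is_derive_cst (gamma u)^T (0 : R) (1 : R)).
    by rewrite mul0mx addr0 mulmx0 add0r.
apply: (is_derive_mem_vspace GammaY).
have d1 := is_derive_mulmx dgamma (is_derive_cst Y (0 : R) (1 : R)).
have := is_derive_mulmx d1 (is_derive_linear trmx dgamma).
rewrite /= gamma0 mul1mx trmx1 mulmx1 mulmx0 add0r (lie_algebra_skew cG gG Xg).
by rewrite mulmxN addrC; apply.
Qed.

(** Differentiate [gamma u *m delta v = delta v *m gamma u] first in [v], then in [u]. *)
Lemma lie_algebra_comm T t X Y :
  (forall A B, T A -> T B -> A *m B = B *m A) -> is_lie_algebra_of T t ->
  X \in t -> Y \in t -> X *m Y = Y *m X.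
Proof.
move=> Tcomm tT /tT[gamma [_ gammaT dgamma]] /tT[delta [_ deltaT ddelta]].
have commY u : gamma u *m Y = Y *m gamma u.
  have dcst := is_derive_cst (gamma u) (0 : R) (1 : R).
  have [_ d1] := is_derive_mulmx dcst ddelta.
  have [_ d2] := is_derive_mulmx ddelta dcst.
  move: d1 d2; rewrite mul0mx addr0 mulmx0 add0r => <- <-.
  congr ('D_(1 : R) _ (0 : R)).
  by apply/funext => v; exact: (Tcomm _ _ (gammaT u) (deltaT v)).
have [_ d1] := is_derive_mulmx dgamma (is_derive_cst Y (0 : R) (1 : R)).
have [_ d2] := is_derive_mulmx (is_derive_cst Y (0 : R) (1 : R)) dgamma.
move: d1 d2; rewrite mulmx0 add0r mul0mx addr0 => <- <-.
congr ('D_(1 : R) _ (0 : R)).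
by apply/funext => u; apply: commY.
Qed.

(** * The trace form as a Euclidean inner product *)

Lemma ipE A B : ip A B = \sum_i \sum_j A i j * B i j.
Proof.
rewrite /ip /mxtrace exchange_big; apply: eq_bigr => i _; rewrite mxE.
by apply: eq_bigr => j _; rewrite mxE.
Qed.

Lemma ipC A B : ip A B = ip B A.
Proof.
by rewrite !ipE; apply: eq_bigr => i _; apply: eq_bigr => j _; rewrite mulrC.
Qed.

Lemma ip_linear A : linear_for *%R (ip A).
Proof. by move=> a X Y; rewrite /ip mulmxDr -scalemxAr linearD linearZ. Qed.

HB.instance Definition _ A := GRing.isLinear.Build R 'M[R]_N R *%R (ip A)
  (ip_linear A).

Lemma ip_ge0 A : 0 <= ip A A.
Proof.
rewrite ipE; apply: sumr_ge0 => i _; apply: sumr_ge0 => j _.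
by rewrite -expr2 sqr_ge0.
Qed.

Lemma ip_eq0 A : (ip A A == 0) = (A == 0).
Proof.
apply/eqP/eqP => [|->]; last by rewrite raddf0.
rewrite ipE => A0; apply/matrixP => i j; rewrite mxE.
have sq_ge0 k l : 0 <= A k l * A k l by rewrite -expr2 sqr_ge0.
have row_ge0 k : 0 <= \sum_l A k l * A k l by apply: sumr_ge0.
have Ai0 : \sum_l A i l * A i l = 0 by apply: (psumr_eq0P _ A0).
have /eqP : A i j * A i j = 0 by apply: (psumr_eq0P _ Ai0).
by rewrite mulf_eq0 orbb => /eqP.
Qed.

(* A is the orthogonal projection of K on t, computed from a Gram matrix. *)
Lemma ip_riesz t K : exists2 A, A \in t & forall H, H \in t -> ip A H = ip K H.
Proof.
pose d := \dim t; pose b i := (vbasis t)`_i.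
pose Gr : 'M[R]_d := \matrix_(i, j) ip (b i) (b j).
have bt (i : 'I_d) : b i \in t by apply/vbasis_mem/mem_nth; rewrite size_tuple.
have expand H : H \in t -> exists c : 'rV[R]_d, H = \sum_i c 0 i *: b i.
  move=> /coord_vbasis ->; exists (\row_i coord (vbasis t) i H).
  by apply: eq_bigr => i _; rewrite mxE.
(* A vector [u] in the kernel of the Gram matrix gives a combination [A] of norm zero, and the basis
   is free. *)
have Gr_unit : Gr \in unitmx.
  rewrite -row_free_unit -kermx_eq0; apply/rowV0P => u /sub_kermxP uGr.
  pose A := \sum_i u 0 i *: b i.
  have : ip A A == 0.
    rewrite {2}/A raddf_sum big1 // => j _ /=.
    rewrite linearZ /= ipC raddf_sum /=.
    apply/eqP; rewrite mulf_eq0; apply/orP; right; apply/eqP.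
    move/matrixP/(_ 0 j): uGr; rewrite !mxE => uGrj; rewrite -[RHS]uGrj.
    by apply: eq_bigr => i _; rewrite linearZ /= mxE ipC.
  rewrite ip_eq0 => /eqP A0; apply/rowP => i; rewrite mxE.
  have /freeP/(_ (u 0))-> // := basis_free (vbasisP t).
pose k : 'rV[R]_d := \row_j ip K (b j); pose a := k *m invmx Gr.
exists (\sum_i a 0 i *: b i); first by apply: memv_suml => i _; apply: memvZ.
move=> H /expand[c ->]; rewrite !raddf_sum; apply: eq_bigr => j _ /=.
rewrite !linearZ /=; congr (_ * _); rewrite ipC raddf_sum /=.
have /matrixP/(_ 0 j) : a *m Gr = k by rewrite mulmxKV.
rewrite mxE [RHS]mxE => <-; apply: eq_bigr => i _.
by rewrite linearZ /= [Gr _ _]mxE ipC.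
Qed.

(** Subtract from a vector of [t] outside [U] its projection on [U]. *)
Lemma subspace_orthogonal U t :
  (U <= t)%VS -> U != t ->
  exists H : 'M[R]_N, [/\ H \in t, H != 0 & forall A, A \in U -> ip A H = 0].
Proof.
move=> Ut UNt; have /subvPn[K Kt KU] : ~~ (t <= U)%VS.
  by apply: contra UNt => tU; rewrite eqEsubv Ut.
have [A AU AK] := ip_riesz U K; exists (K - A); split.
- by rewrite memvB // (subvP Ut).
- by rewrite subr_eq0; apply: contraNneq KU => ->.
- by move=> B BU; rewrite raddfB /= ipC -AK // ipC subrr.
Qed.

End LieAlgebra.

(** * Common eigenvectors of commuting real matrices *)

Lemma real_common_eigenvector (R : rcfType) m n (As : seq 'M[R]_n)
    (V : 'M[R]_(m, n)) :
  {in As &, forall A B, A *m B = B *m A} ->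
  {in As, forall A, (V *m A <= V)%MS} -> V != 0 ->
  exists x y : 'rV[R]_n,
    [/\ (x <= V)%MS, (y <= V)%MS, (x != 0) || (y != 0) &
        {in As, forall A, exists p q : R,
           x *m A = p *: x - q *: y /\ y *m A = p *: y + q *: x}].
Proof.
move=> As_comm V_stable V0; pose W := row_base V.
have [eqWV Wfree] : (W :=: V)%MS /\ row_free W.
  by split; [apply: eq_row_base | apply: row_base_free].
clearbody W.
have W_stable A : A \in As -> (W *m A <= W)%MS.
  move=> /V_stable; rewrite eqWV; apply: submx_trans.
  by rewrite submxMr // eqWV.
(* In the basis [W] of the stable row space, each [A] acts by a square matrix [rs A]. *)
have [rs rsE] : exists rs : 'M[R]_n -> 'M[R]_(\rank V),
    forall A, A \in As -> rs A *m W = W *m A.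
  exists (fun A => W *m A *m pinvmx W) => A AAs.
  by rewrite mulmxKpV // W_stable.
pose rsC A := map_mx (real_complex R) (rs A).
have rs_comm : {in map rsC As &, forall A B, comm_mx A B}.
  move=> _ _ /mapP[A AAs ->] /mapP[B BAs ->]; rewrite /comm_mx /rsC -!map_mxM.
  congr map_mx; apply: (row_free_inj Wfree).
  rewrite /= -!mulmxA !rsE // !mulmxA !rsE // -!mulmxA.
  by rewrite As_comm.
have rV0 : (0 < \rank V)%N by rewrite lt0n mxrank_eq0.
(* Over the complex numbers the commuting restrictions share an eigenvector [v]. Its real and
   imaginary parts give the two real vectors, and [p], [q] are those of the eigenvalue. *)
have [v v0 /allP v_stable] := common_eigenvector rV0 rs_comm.
pose x := map_mx (@complex.Re R) v; pose y := map_mx (@complex.Im R) v.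
exists (x *m W), (y *m W); split.
- by rewrite -eqWV submxMl.
- by rewrite -eqWV submxMl.
- rewrite !mulmx_free_eq0  // -negb_and.
  apply: contra v0 => /andP[/eqP x0 /eqP y0]; apply/eqP/rowP => i.
  move/rowP/(_ i): x0; move/rowP/(_ i): y0; rewrite !mxE.
  by case: (v 0 i) => a b /= -> ->.
move=> A AAs; have /v_stable/eigenvectorP[c /eigenspaceP vc] :
    rsC A \in map rsC As.
  by apply/mapP; exists A.
exists (complex.Re c), (complex.Im c).
rewrite -!mulmxA -!rsE // !mulmxA !scalemxAl.
rewrite -mulmxBl -mulmxDl; split; congr (_ *m W); apply/rowP => i.
  move/rowP/(_ i): vc; rewrite !mxE => /(congr1 (@complex.Re R)).
  rewrite (raddf_sum (@complex.Re R : Rcomplex R -> R)).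
  case: (v 0 i) c => [a b] [a' b'] /= <-; apply: eq_bigr => j _.
  by rewrite !mxE; case: (v 0 j) => /= ? ?; rewrite mulr0 subr0.
move/rowP/(_ i): vc; rewrite !mxE => /(congr1 (@complex.Im R)).
rewrite (raddf_sum (@complex.Im R : Rcomplex R -> R)).
case: (v 0 i) c => [a b] [a' b'] /= <-; apply: eq_bigr => j _.
by rewrite !mxE; case: (v 0 j) => /= ? ?; rewrite mulr0 add0r.
Qed.

(** * Existence of roots, and the span of a base *)

Section Roots.
Context {R : realType} {N : nat}.
Implicit Types (G T : set 'M[R]_N) (g t : {vspace 'M[R]_N}).
Implicit Types (A B H K X Y : 'M[R]_N) (D : seq 'M[R]_N).

Lemma ipZr (a : R) A B : ip A (a *: B) = a * ip A B.
Proof. exact: linearZ. Qed.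

Lemma lie_bracketC X Y : lie_bracket X Y = - lie_bracket Y X.
Proof. by rewrite /lie_bracket opprB. Qed.

Lemma lie_bracket_linear X : linear (@lie_bracket R N X).
Proof.
move=> a Y Z; rewrite /lie_bracket mulmxDr mulmxDl -scalemxAr -scalemxAl.
by rewrite scalerBr opprD addrACA.
Qed.

HB.instance Definition _ X := GRing.isLinear.Build R 'M[R]_N 'M[R]_N *:%R
  (@lie_bracket R N X) (lie_bracket_linear X).

(** The Jacobi identity, in which the term containing [lie_bracket H K] vanishes. *)
Lemma lie_bracketCA H K X :
  lie_bracket H K = 0 ->
  lie_bracket H (lie_bracket K X) = lie_bracket K (lie_bracket H X).
Proof.
rewrite /lie_bracket => /eqP; rewrite subr_eq0 => /eqP HK.
rewrite !mulmxBr !mulmxBl !mulmxA HK -(mulmxA X H K) HK (mulmxA X K H).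
rewrite !opprB addrACA.
by rewrite [RHS]addrACA; congr (_ + _); rewrite addrC.
Qed.

(** By cyclicity of the trace, the adjoint of bracketing with [H] is bracketing with [H^T]. *)
Lemma ip_bracket_skew H X Y :
  H^T = - H -> ip (lie_bracket H X) Y = - ip X (lie_bracket H Y).
Proof.
move=> skewH; rewrite /ip /lie_bracket raddfB /= !trmx_mul skewH.
rewrite mulmxBr mulmxBl.
rewrite mulmxN !mulNmx opprK linearD linearN linearB /= opprB addrC !mulmxA.
by rewrite -(mulmxA H) (mxtrace_mulC H).
Qed.

(** Turns a functional of [H] into the pairing with a fixed matrix, which is how the eigenvalue of a
    root vector gets represented. *)
Lemma ip_bracket X Y H :
  ip X (lie_bracket H Y) = ip (Y *m X^T - X^T *m Y)^T H.
Proof.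
rewrite /ip trmxK /lie_bracket mulmxBr mulmxBl !raddfB /=; congr (_ - _).
  by rewrite mulmxA mxtrace_mulC mulmxA.
by rewrite mulmxA.
Qed.

(* ad t acts on the image of ad H0 with a common complex eigenvector X + iY; as
   ad t is skew its eigenvalues are imaginary, and they are not zero at H0
   because ad H0 is injective on its own image. *)
Lemma exists_root g t H0 X0 :
  {subset t <= g} -> (forall H, H \in t -> H^T = - H) ->
  (forall H X, H \in t -> X \in g -> lie_bracket H X \in g) ->
  (forall H K, H \in t -> K \in t -> lie_bracket H K = 0) ->
  H0 \in t -> X0 \in g -> lie_bracket H0 X0 != 0 ->
  exists2 A, is_root g t A & ip A H0 != 0.
Proof.
move=> tg t_skew t_bracket t_comm H0t X0g H0X0.
pose ad H : 'M[R]_(N * N) := lin_mx (lie_bracket H).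
have adE H X : mxvec X *m ad H = mxvec (lie_bracket H X) by rewrite mul_vec_lin.
have ad_comm H K : H \in t -> K \in t -> ad H *m ad K = ad K *m ad H.
  move=> Ht Kt; apply/row_matrixP => i; rewrite !rowE !mulmxA.
  rewrite -(vec_mxK (delta_mx 0 i)) !adE lie_bracketCA //.
  exact: t_comm.
(* The rows are a flattened basis of [g], so membership in [g] becomes inclusion in a row space. *)
pose M : 'M[R]_(\dim g, N * N) := \matrix_i mxvec (vbasis g)`_i.
have Mg X : (mxvec X <= M)%MS = (X \in g).
  apply/submxP/idP => [[u uM]|Xg].
    rewrite -(mxvecK X) uM mulmx_sum_row raddf_sum.
    apply: memv_suml => i _; rewrite /= linearZ /= rowK mxvecK.
    by apply/memvZ/vbasis_mem/mem_nth; rewrite size_tuple.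
  exists (\row_i coord (vbasis g) i X).
  rewrite {1}(coord_vbasis Xg) raddf_sum mulmx_sum_row; apply: eq_bigr => i _.
  by rewrite /= linearZ rowK mxE.
have MgP (u : 'rV_(N * N)) : (u <= M)%MS = (vec_mx u \in g).
  by rewrite -Mg vec_mxK.
pose As := [seq ad H | H <- vbasis t].
pose V := M *m ad H0.
have V_im (x : 'rV_(N * N)) : (x <= V)%MS ->
    exists2 X, X \in g & vec_mx x = lie_bracket H0 X.
  case/submxP => u ->; exists (vec_mx (u *m M)).
    by rewrite -MgP submxMl.
  by apply: (can_inj mxvecK); rewrite -adE !vec_mxK mulmxA.
have [||| x [y [xV yV xy0 xyA]]] := @real_common_eigenvector R _ _ As V.
- move=> _ _ /mapP[H Ht ->] /mapP[K Kt ->].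
  by apply: ad_comm; apply: vbasis_mem.
- move=> _ /mapP[H /vbasis_mem Ht ->]; rewrite /V -mulmxA ad_comm // mulmxA.
  apply/submxMr/row_subP => i; rewrite row_mul rowK adE Mg t_bracket //.
  by apply/vbasis_mem/mem_nth; rewrite size_tuple.
- apply: contraNneq H0X0 => V0; move: X0g; rewrite -Mg => /submxP[u uM].
  by rewrite -(inj_eq (can_inj mxvecK)) -adE uM -mulmxA -/V V0 mulmx0 linear0.
have [X1 X1g xX1] := V_im x xV; have [Y1 Y1g yY1] := V_im y yV.
set X := vec_mx x in xX1; set Y := vec_mx y in yY1.
have XY0 : (X != 0) || (Y != 0).
  apply: contraTT xy0; rewrite !negb_or !negbK /X /Y.
  by rewrite -!(inj_eq (can_inj vec_mxK)) !linear0.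
have Xg : X \in g by rewrite xX1 t_bracket.
have Yg : Y \in g by rewrite yY1 t_bracket.
pose S := ip X X + ip Y Y.
have S0 : S != 0.
  apply: contraTN XY0; rewrite paddr_eq0 ?ip_ge0 // !ip_eq0.
  by case/andP=> /eqP-> /eqP->; rewrite eqxx.
(* The eigenvector equation is known on a basis of [t] only; it extends to [t] because the bracket
   is linear in [H]. *)
have eigen H : H \in t -> exists p q,
    lie_bracket H X = p *: X - q *: Y /\ lie_bracket H Y = p *: Y + q *: X.
  move=> Ht.
  have basis_eigen (i : 'I_(\dim t)) : exists p q,
      lie_bracket (vbasis t)`_i X = p *: X - q *: Y /\
      lie_bracket (vbasis t)`_i Y = p *: Y + q *: X.
    have /xyA[p [q [xA yA]]] : ad (vbasis t)`_i \in As.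
      by apply/map_f/mem_nth; rewrite size_tuple.
    exists p, q; split; apply: (can_inj mxvecK); rewrite -adE vec_mxK.
      by rewrite xA linearB !linearZ /= !vec_mxK.
    by rewrite yA linearD !linearZ /= !vec_mxK.
  have bracketE Z : lie_bracket H Z =
      \sum_i coord (vbasis t) i H *: lie_bracket (vbasis t)`_i Z.
    rewrite {1}(coord_vbasis Ht) lie_bracketC raddf_sum -sumrN /=.
    by apply: eq_bigr => i _; rewrite linearZ /= lie_bracketC scalerN opprK.
  rewrite !bracketE.
  pose P Z W := exists p q : R, Z = p *: X - q *: Y /\ W = p *: Y + q *: X.
  apply: (big_ind2 P) => [|Z1 W1 Z2 W2|i _].
  - by exists 0, 0; rewrite !scale0r subr0 addr0.
  - move=> [p1 [q1 [-> ->]]] [p2 [q2 [-> ->]]]; exists (p1 + p2), (q1 + q2).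
    by rewrite !scalerDl opprD; split; rewrite addrACA.
  - have [p [q [-> ->]]] := basis_eigen i; set c := coord _ _ _.
    exists (c * p), (c * q).
    by rewrite scalerBr scalerDr !scalerA.
(* For an imaginary eigenvalue with imaginary part [q], the number [ip X (lie_bracket H Y) - ip Y
   (lie_bracket H X)] is [q * S]. By [ip_bracket] it is a pairing with [H], so [K] represents
   [q]. *)
pose K := S^-1 *: ((Y *m X^T - X^T *m Y)^T - (X *m Y^T - Y^T *m X)^T).
have K_eigen H : H \in t ->
    lie_bracket H X = - ip K H *: Y /\ lie_bracket H Y = ip K H *: X.
  move=> Ht; have [p [q [HX HY]]] := eigen _ Ht.
  have XX := ip_bracket_skew X X (t_skew _ Ht).
  have YY := ip_bracket_skew Y Y (t_skew _ Ht).
  (* Skewness makes [ip X (lie_bracket H X)] and [ip Y (lie_bracket H Y)] vanish. In their sum the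
     terms in [q] cancel, leaving [p * S]. *)
  have p0 : p = 0.
    rewrite HX ipC raddfB /= !ipZr in XX.
    rewrite HY ipC raddfD /= !ipZr (ipC Y X) in YY.
    have /eqP : p * S = 0 by rewrite /S; lra.
    by rewrite mulf_eq0 (negPf S0) orbF => /eqP.
  have KH : ip K H = q.
    rewrite ipC /K ipZr raddfB /= ipC (ipC H) -!ip_bracket HX HY p0.
    rewrite !scale0r add0r sub0r raddfN /= !ipZr opprK -mulrDr mulrCA.
    by rewrite mulVf // mulr1.
  by rewrite HX HY KH p0 !scale0r !add0r scaleNr.
(* [K] need not lie in [t], but its projection on [t] has the same pairings with [t]. *)
have [A At AK] := ip_riesz t K.
have A0 : ip A H0 != 0.
  (* Otherwise bracketing with [H0] would kill [X] and [Y], which also lie in its image; by skewness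
     both would be orthogonal to themselves. *)
  apply: contraNneq S0; rewrite (AK _ H0t) => KH0.
  have [HX HY] := K_eigen _ H0t; rewrite KH0 oppr0 !scale0r in HX HY.
  rewrite /S {1}xX1 {1}yY1 !ip_bracket_skew ?t_skew // HX HY.
  by rewrite !raddf0 addr0.
exists A => //; split=> //.
  by apply: contraNneq A0 => ->; rewrite ipC raddf0.
by exists X, Y; split=> // H Ht; rewrite AK //; apply: K_eigen.
Qed.

Lemma base_span G T g t D :
  compact_lie_group G -> is_lie_algebra_of G g -> simple_lie_algebra g ->
  torus_in G T -> is_lie_algebra_of T t -> is_base g t D -> <<D>>%VS = t.
Proof.
move=> cG gG [[X [Y [Xg Yg XY]]] g_simple] [TG _ _ Tcomm] tT [_ Droot Dgen].
have tg := lie_algebraS TG gG tT.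
have Dt : (<<D>> <= t)%VS by apply/span_subvP => A /Droot[].
apply/eqP/negPn/negP => /(subspace_orthogonal Dt)[H [Ht H0 Horth]].
have H_central Z : Z \in g -> lie_bracket H Z = 0.
  move=> Zg; apply/eqP/negPn/negP => HZ.
  have [|||A Aroot] := exists_root tg _ _ _ Ht Zg HZ.
  - by move=> K Kt; apply: (lie_algebra_skew cG gG); apply: tg.
  - by move=> K Z' Kt; apply: (lie_algebra_bracket cG gG); apply: tg.
  - move=> K K' Kt K't; apply/eqP; rewrite subr_eq0; apply/eqP.
    exact: (lie_algebra_comm Tcomm tT).
  suff -> : ip A H = 0 by rewrite eqxx.
  apply: Horth; have [k Ak] := Dgen A Aroot.
  have sumD : \sum_(i < size D) D`_i *+ k i \in <<D>>%VS.
    by apply: memv_suml => i _; apply/rpredMn/memv_span/mem_nth.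
  by case: Ak => ->; rewrite ?memvN.
(* The line through the central [H] is an ideal. It is nonzero as [H] is, and it cannot be [g],
   which contains two elements that do not commute. *)
have [||] := g_simple <[H]>%VS.
- split; first by rewrite -memvE tg.
  move=> Z _ Zg /vlineP[a ->].
  by rewrite linearZ /= lie_bracketC H_central // oppr0 scaler0 mem0v.
- by move/eqP; rewrite -dimv_eq0 dim_vline (negPf H0).
- move=> gH; move: Xg XY; rewrite -gH => /vlineP[a ->].
  rewrite lie_bracketC linearZ /= lie_bracketC H_central //.
  by rewrite oppr0 scaler0 oppr0 eqxx.
Qed.

End Roots.

(** * Words in the nodes of the diagram and their normal forms *)

Definition coxeter_order (X : deligne_ade) : nat :=
  match X with A1 => 2 | A2 => 3 | D4 => 6 | E6 => 12 | E7 => 18 | E8 => 30 end.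

Definition adjacent (X : deligne_ade) (i j : nat) : bool :=
  (i != j) && (((i, j) \in dynkin_edges X) || ((j, i) \in dynkin_edges X)).

Definition neighbours (X : deligne_ade) (i : nat) : seq nat :=
  [seq j <- iota 0 (dynkin_nodes X) | adjacent X i j].

Definition neighbour_table (X : deligne_ade) : seq (seq nat) :=
  [seq neighbours X i | i <- iota 0 (dynkin_nodes X)].

(* The action of a simple reflection on coordinates in a simply laced base:
   v_i becomes the sum of the v_j over the neighbours j of i, minus v_i. *)
Definition reflect_coords (nbs : seq (seq nat)) (i : nat) (v : seq int) :
    seq int :=
  set_nth 0 v i
    (foldr (fun j a => v`_j + a) (- v`_i) (nth [::] nbs i)).

Definition act_coords (nbs : seq (seq nat)) (w : seq nat) (v : seq int) :=
  foldr (reflect_coords nbs) v w.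

Definition unit_coords (n i : nat) : seq int :=
  mkseq (fun j => Posz (j == i)) n.

Definition normal_step (X : deligne_ade) (x y : nat) : bool :=
  (x <= y)%N || adjacent X x y.

(* Two commuting letters may be exchanged, so every word can be brought to a
   form in which each descent is between adjacent nodes; only 160 of the 8!
   words are left to examine for E8. *)
Fixpoint normal_words (X : deligne_ade) (k : nat) : seq (seq nat) :=
  if k is k'.+1 then
    [seq x :: u | u <- normal_words X k',
                  x <- [seq x <- iota 0 (dynkin_nodes X) |
                         (x \notin u) && path (normal_step X) x u]]
  else [:: [::]].

(** Absence of an earlier return is tested on the first basis vector alone, which is enough for a
    lower bound on the order; the trajectory lists its images under the powers 1 to [h.-1]. *)
Definition acts_with_order (nbs : seq (seq nat)) (n h : nat) (w : seq nat) :
    bool :=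
  let act := act_coords nbs w in
  all (fun i => iter h act (unit_coords n i) == unit_coords n i) (iota 0 n) &&
  (unit_coords n 0 \notin traject act (act (unit_coords n 0)) h.-1).

Lemma normal_words_order X :
  all (acts_with_order (neighbour_table X) (dynkin_nodes X) (coxeter_order X))
      (normal_words X (dynkin_nodes X)).
Proof. by case: X; vm_compute. Qed.

(** A step of insertion sort in which [x] passes [y] only if [y < x] and the two nodes are not
    adjacent, so that their reflections commute. *)
Fixpoint insert_letter (X : deligne_ade) (x : nat) (u : seq nat) : seq nat :=
  if u is y :: u' then
    if normal_step X x y then x :: u else y :: insert_letter X x u'
  else [:: x].

Definition normalize X (w : seq nat) := foldr (insert_letter X) [::] w.

Lemma perm_insert_letter X x u : perm_eq (insert_letter X x u) (x :: u).
Proof.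
elim: u => //= y u IHu; case: ifP => // _.
rewrite -(cat1s y) -(cat1s x) -(cat1s y u) perm_sym perm_catCA /= perm_cons.
by rewrite perm_sym.
Qed.

(** A letter [y] that is passed is smaller than [x], so it may precede [x]; the recursive result
    starts with [x] or with the former successor of [y]. *)
Lemma sorted_insert_letter X x u :
  sorted (normal_step X) u -> sorted (normal_step X) (insert_letter X x u).
Proof.
elim: u => //= y u IHu yu; case: ifPn => [xy|xy] /=; first by rewrite xy.
have step_yx : normal_step X y x.
  by move: xy; rewrite /normal_step negb_or -ltnNge => /andP[/ltnW->].
case: u yu IHu => [|z u] /=; first by rewrite step_yx.
by case/andP=> yz zu /(_ zu); case: ifP => /= _ ->; rewrite ?step_yx ?yz.
Qed.

Lemma perm_normalize X w : perm_eq (normalize X w) w.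
Proof.
elim: w => //= x w IHw; apply: (perm_trans (perm_insert_letter _ _ _)).
by rewrite perm_cons.
Qed.

Lemma sorted_normalize X w : sorted (normal_step X) (normalize X w).
Proof. by elim: w => //= x w; apply: sorted_insert_letter. Qed.

Lemma mem_normal_words X u :
  uniq u -> all (fun i => i < dynkin_nodes X)%N u -> sorted (normal_step X) u ->
  u \in normal_words X (size u).
Proof.
elim: u => [|x u IHu] //= /andP[xu u_uniq] /andP[x_lt u_lt] u_sorted.
apply/allpairsPdep; exists u, x; split=> //.
  by apply: IHu => //; apply: path_sorted u_sorted.
by rewrite mem_filter xu u_sorted mem_iota.
Qed.

Lemma normalize_order X w :
  perm_eq w (iota 0 (dynkin_nodes X)) ->
  acts_with_order (neighbour_table X) (dynkin_nodes X) (coxeter_order X)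
    (normalize X w).
Proof.
move=> w_perm; have nw := perm_trans (perm_normalize X w) w_perm.
apply: (allP (normal_words_order X)).
rewrite -(size_iota 0 (dynkin_nodes X)) -(perm_size nw).
apply: mem_normal_words; last exact: sorted_normalize.
  by rewrite (perm_uniq nw) iota_uniq.
by apply/allP => i; rewrite (perm_mem nw) mem_iota.
Qed.

(** * Reflections of matrices and their action on coordinates *)

Section Reflections.
Context {R : realType} {N : nat}.
Implicit Types (A B H : 'M[R]_N) (s : seq 'M[R]_N).

Lemma cartan_integer_is_scalar A : scalar (cartan_integer A : 'M[R]_N -> R).
Proof.
move=> a B H; rewrite /cartan_integer /ip mulmxDr -scalemxAr linearD linearZ /=.
by rewrite mulrDr mulrDl mulrCA !mulrA.
Qed.

HB.instance Definition _ A := GRing.isLinear.Build R 'M[R]_N R *%R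
  (cartan_integer A) (cartan_integer_is_scalar A).

Lemma reflection_linear A : linear (reflection A).
Proof.
move=> a B H; rewrite /reflection cartan_integer_is_scalar scalerDl.
by rewrite -scalerA scalerBr opprD addrACA.
Qed.

Lemma product_of_reflections_linear s : linear (product_of_reflections s).
Proof.
elim: s => [|A s IHs] a B H //=.
by rewrite IHs reflection_linear.
Qed.

Lemma iter_linear (f : 'M[R]_N -> 'M[R]_N) k : linear f -> linear (iter k f).
Proof. by move=> f_lin; elim: k => [|k IHk] a B H //=; rewrite IHk f_lin. Qed.

(** Each reflection fixes the other root, so both sides subtract the same two multiples from [H]. *)
Lemma reflection_comm A B H :
  cartan_integer A B = 0 -> cartan_integer B A = 0 ->
  reflection A (reflection B H) = reflection B (reflection A H).
Proof.
have cartanB A' B' c : cartan_integer A' (H - c *: B') =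
    cartan_integer A' H - c * cartan_integer A' B'.
  have := cartan_integer_is_scalar A' (- c) B' H.
  by rewrite scaleNr mulNr ![- _ + _]addrC.
by move=> AB BA; rewrite /reflection !cartanB AB BA !mulr0 !subr0 addrAC.
Qed.

Lemma linear_fixed_span (f : 'M[R]_N -> 'M[R]_N) s :
  linear f -> {in s, forall A, f A = A} ->
  forall H, H \in << s >>%VS -> f H = H.
Proof.
move=> f_lin f_fix H /(coord_span (X := in_tuple s)) ->.
have f0 : f 0 = 0.
  by have := f_lin (-1) 0 0; rewrite scaler0 addr0 scaleN1r addNr.
apply: (big_ind (fun A => f A = A)) => [//|A B fA fB|i _].
  by have := f_lin 1 A B; rewrite !scale1r fA fB.
have := f_lin (coord (in_tuple s) i H) s`_i 0.
by rewrite !addr0 f0 addr0 (f_fix s`_i) ?mem_nth.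
Qed.

Section Coordinates.
Variables (X : deligne_ade) (s : seq 'M[R]_N).
Hypothesis size_s : size s = dynkin_nodes X.
Hypothesis s_cartan : forall i j, (i < size s)%N -> (j < size s)%N ->
  cartan_integer s`_i s`_j = (cartan_matrix X i j)%:~R.

Definition of_coords (v : seq int) : 'M[R]_N :=
  \sum_(j < size s) (v`_j)%:~R *: s`_j.

Lemma cartan_matrixE i j :
  cartan_matrix X i j = (i == j)%:R *+ 2 - (adjacent X i j)%:R.
Proof.
rewrite /cartan_matrix /adjacent; case: eqP => //= _; rewrite mul0rn sub0r.
by case: ifP.
Qed.

(** Only coordinate [i] changes. The amount subtracted is twice that coordinate minus the sum over
    the neighbours, that is the coordinate minus [b], which leaves [b]. *)
Lemma reflect_coordsE i v : (i < size s)%N ->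
  reflection s`_i (of_coords v) =
  of_coords (reflect_coords (neighbour_table X) i v).
Proof.
move=> i_lt; rewrite /reflection /reflect_coords.
set b := foldr _ _ _.
have bE : b = \sum_(j < size s) v`_j * (adjacent X i j)%:R - v`_i.
  rewrite /b /neighbour_table (nth_map 0%N) ?size_iota -?size_s //.
  rewrite nth_iota -?size_s // /neighbours -size_s add0n.
  have foldE (l : seq nat) :
      foldr (fun j a => v`_j + a) (- v`_i) l = \sum_(j <- l) v`_j - v`_i.
    by elim: l => [|j l IHl] /=; rewrite ?big_nil ?sub0r // big_cons IHl addrA.
  rewrite foldE; congr (_ - _); rewrite big_filter big_mkcond /=.
  have -> : iota 0 (size s) = index_iota 0 (size s).
    by rewrite /index_iota subn0.
  rewrite big_mkord.
  by apply: eq_bigr => j _; case: adjacent; rewrite ?mulr1 ?mulr0.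
have cE : cartan_integer s`_i (of_coords v) =
    (\sum_(j < size s) v`_j * cartan_matrix X i j)%:~R.
  rewrite /of_coords raddf_sum rmorph_sum; apply: eq_bigr => j _ /=.
  by rewrite linearZ /= s_cartan // rmorphM.
have cb : \sum_(j < size s) v`_j * cartan_matrix X i j = v`_i - b.
  rewrite bE opprB addrA -mulr2n.
  under eq_bigr => j _ do rewrite cartan_matrixE mulrBr.
  rewrite sumrB; congr (_ - _); rewrite (bigD1 (Ordinal i_lt)) //= eqxx.
  rewrite big1 ?addr0 => [|j ji]; first by rewrite mulrnAr mulr1.
  rewrite eq_sym -[(j : nat) == i]/(j == Ordinal i_lt) (negPf ji).
  by rewrite mul0rn mulr0.
rewrite cE cb /of_coords [X in X - _](bigD1 (Ordinal i_lt)) //=.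
rewrite [RHS](bigD1 (Ordinal i_lt)) //= nth_set_nth /= eqxx.
rewrite addrAC -scalerBl -rmorphB subKr; congr (_ + _).
apply: eq_bigr => j ji; rewrite nth_set_nth /=.
by rewrite -[(j : nat) == i]/(j == Ordinal i_lt) (negPf ji).
Qed.

Lemma act_coordsE w v : all (fun i => i < size s)%N w ->
  product_of_reflections [seq s`_i | i <- w] (of_coords v) =
  of_coords (act_coords (neighbour_table X) w v).
Proof.
by elim: w => //= i w IHw /andP[i_lt /IHw->]; apply: reflect_coordsE.
Qed.

Lemma iter_act_coordsE w v k : all (fun i => i < size s)%N w ->
  iter k (product_of_reflections [seq s`_i | i <- w]) (of_coords v) =
  of_coords (iter k (act_coords (neighbour_table X) w) v).
Proof. by move=> w_lt; elim: k => //= k ->; apply: act_coordsE. Qed.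

Lemma of_unit_coords i : (i < size s)%N ->
  of_coords (unit_coords (dynkin_nodes X) i) = s`_i.
Proof.
move=> i_lt; rewrite /of_coords (bigD1 (Ordinal i_lt)) //=.
rewrite nth_mkseq -?size_s // eqxx scale1r big1 ?addr0 // => j ji.
rewrite nth_mkseq -?size_s //.
by rewrite -[(j : nat) == i]/(j == Ordinal i_lt) (negPf ji) scale0r.
Qed.

(** Freeness determines the coefficients, and integers embed in the reals. The sizes are fixed
    because [of_coords] reads missing entries as 0 and ignores extra ones. *)
Lemma of_coords_inj u v : free s ->
  size u = size s -> size v = size s -> of_coords u = of_coords v -> u = v.
Proof.
move=> s_free size_u size_v /eqP.
rewrite -subr_eq0 /of_coords -sumrB => /eqP uv.
apply: (@eq_from_nth _ 0); rewrite size_u // => i i_lt.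
have /freeP/(_ (fun j => (u`_j - v`_j)%:~R)) : free (in_tuple s) by [].
move=> /(_ _ (Ordinal i_lt)) uvi; apply/eqP; rewrite -subr_eq0.
rewrite -(@intr_eq0 R) uvi // -[RHS]uv.
by apply: eq_bigr => j _; rewrite rmorphB scalerBl.
Qed.

Lemma size_act_coords w v : all (fun i => i < size v)%N w ->
  size (act_coords (neighbour_table X) w v) = size v.
Proof.
elim: w => //= i w IHw /andP[i_lt /IHw size_w].
by rewrite size_set_nth size_w; apply/maxn_idPr.
Qed.

(** Letters are exchanged only when distinct and not adjacent; their Cartan integers then vanish
    both ways and [reflection_comm] applies. *)
Lemma insert_letterE x u H :
  (x < size s)%N -> all (fun i => i < size s)%N u ->
  product_of_reflections [seq s`_i | i <- insert_letter X x u] H =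
  reflection s`_x (product_of_reflections [seq s`_i | i <- u] H).
Proof.
move=> x_lt; elim: u => //= y u IHu /andP[y_lt u_lt].
case: ifPn => //; rewrite negb_or -ltnNge => /andP[yx /negPf xy] /=.
rewrite IHu //; apply: reflection_comm; rewrite s_cartan // cartan_matrixE.
  rewrite (ltn_eqF yx) /adjacent eq_sym orbC -/(adjacent X x y) xy.
  by rewrite mul0rn subrr.
by rewrite (gtn_eqF yx) xy mul0rn subrr.
Qed.

Lemma normalizeE w : all (fun i => i < size s)%N w ->
  product_of_reflections [seq s`_i | i <- normalize X w] =
  product_of_reflections [seq s`_i | i <- w].
Proof.
move=> w_lt; apply/funext => H; elim: w w_lt => //= x w IHw /andP[x_lt w_lt].
rewrite insert_letterE ?IHw //.
apply/allP => i; rewrite (perm_mem (perm_normalize X w)).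
by move/allP: w_lt; apply.
Qed.

Lemma has_order_product w :
  free s -> perm_eq w (iota 0 (size s)) ->
  has_order << s >>%VS (product_of_reflections [seq s`_i | i <- w])
    (coxeter_order X).
Proof.
move=> s_free w_perm.
have lt_of_perm u :
    perm_eq u (iota 0 (size s)) -> all (fun i => i < size s)%N u.
  by move=> u_perm; apply/allP => i; rewrite (perm_mem u_perm) mem_iota.
rewrite -normalizeE ?lt_of_perm //.
have nw_lt : all (fun i => i < size s)%N (normalize X w).
  by apply/lt_of_perm/(perm_trans (perm_normalize _ _)).
have /andP[] : acts_with_order (neighbour_table X) (dynkin_nodes X)
    (coxeter_order X) (normalize X w).
  by apply: normalize_order; rewrite -size_s.
set act := act_coords _ _ => /allP act_id act_neq.
have s_gt0 : (0 < size s)%N by rewrite size_s; case: (X).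
split; first by case: (X).
- apply: linear_fixed_span.
    by apply/iter_linear/product_of_reflections_linear.
  move=> A /(nthP 0)[i i_lt <-]; rewrite -of_unit_coords // iter_act_coordsE //.
  by congr of_coords; apply/eqP/act_id; rewrite mem_iota -size_s.
(* A smaller power trivial on the span would fix the simple root of index 0; by injectivity of
   coordinates this contradicts the computed trajectory. *)
- move=> k /andP[k_gt0 k_lt] /(_ s`_0).
  rewrite memv_span ?mem_nth // => /(_ isT).
  rewrite -of_unit_coords // iter_act_coordsE // => /of_coords_inj e0.
  (* The trajectory starts at the first image, so the power [k] stands at index [k.-1]. *)
  move/negP: act_neq; apply; apply/trajectP; exists k.-1; first by lia.
  rewrite -iterSr prednK // e0 ?size_mkseq //.
  have size_e0 : size (unit_coords (dynkin_nodes X) 0) = size s.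
    by rewrite size_mkseq.
  rewrite -size_e0; elim: k {k_gt0 k_lt e0} => //= k IHk.
  by rewrite size_act_coords IHk // size_e0.
Qed.

End Coordinates.
End Reflections.

Theorem lemma7p2 (R : realType) (N : nat) (G T : set 'M[R]_N)
    (g t : {vspace 'M[R]_N}) (D : seq 'M[R]_N) (X : deligne_ade) :
  simple_compact_lie_group G g ->
  maximal_torus G T ->
  is_lie_algebra_of T t ->
  is_base g t D ->
  has_dynkin_type D X ->
  exists h : nat,
    is_coxeter_number g t D h /\
    h%:R = 6%:R * ((rank t)%:R + 2%:R) / (10%:R - (rank t)%:R) :> rat.
Proof.
move=> [cG _ gG g_simple] [Ttorus _] tT Dbase [s [sD size_s s_cartan]].
have [D_free D_root _] := Dbase.
have s_free : free s by rewrite (perm_free sD).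
have st : << s >>%VS = t.
  rewrite -(base_span cG gG g_simple Ttorus tT Dbase).
  exact/eq_span/perm_mem.
(* Freeness of [s] is by definition the equality of its size with the dimension of its span. *)
have rank_t : rank t = dynkin_nodes X.
  by rewrite /rank -st -size_s; apply/eqP.
(* Once the rank is known, the formula is a numerical identity for each of the six types. *)
exists (coxeter_order X); split; last by rewrite rank_t; case: (X).
split=> [|c [_ [u uD ->]]].
  exists (product_of_reflections D); split; last by exists D.
  elim: (D) D_root => [|A D' IHD] D_root /=; first exact: weyl_id.
  apply: weyl_reflection; first by apply: D_root; rewrite mem_head.
  by apply: IHD => B BD'; apply: D_root; rewrite inE BD' orbT.
(* [s] lists [D] in the order of the Dynkin labels, so any ordering [u] of [D] is a word using each
   label once. *)
have /(perm_iotaP 0)[w w_perm ->] : perm_eq u s.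
  by rewrite (perm_trans uD) // perm_sym.
by rewrite -st; apply: has_order_product.
Qed.
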